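(* For the (weighted) admission control to minimize rejections problem described in the context, there is a randomized preemptive online algorithm that is $O(\log^2(mc))$-competitive, i.e. the expected total cost of the requests it rejects is at most $O(\log^2(mc))\cdot C_{OPT}$.
   Context: Admission control to minimize rejections: a directed graph $G=(V,E)$ with $|E|=m$ is given, each edge $e$ having an integer capacity $c_e>0$; let $c=\max_{e\in E}c_e$. Requests $r_1,r_2,\ldots$ arrive one at a time; each request $r_i$ is a simple path in $G$ together with a cost $p_i>0$. A feasible solution is a set of accepted requests such that for every edge $e$ the number of accepted requests whose paths contain $e$ is at most $c_e$; its cost is the total cost of the rejected requests. $C_{OPT}$ is the minimum cost of a feasible solution for the whole sequence. The online algorithm must decide upon arrival of each request whether to accept or reject it, and must keep the set of currently accepted requests feasible at all times; it may preempt (reject a previously accepted request) but may never accept a request once rejected. An algorithm is $\beta$-competitive if the (expected) total cost of the requests it rejects is at most $\beta C_{OPT}$. *)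

(* Defs.v *)
(* MathComp + MathComp-Analysis. *)
From HB Require Import structures.
From mathcomp Require Import all_boot all_order all_algebra.
From mathcomp Require Import all_classical all_reals all_analysis.

Set Implicit Arguments.
Unset Strict Implicit.
Unset Printing Implicit Defensive.

Import Order.TTheory GRing.Theory Num.Theory.
Import numFieldNormedType.Exports.

Local Open Scope ring_scope.

(* A directed graph on [V] is given by its set of edges [E : {set V * V}]. *)

(* The path starts at [source] and then visits the vertices of [walk] in order;
   it is simple, i.e. its vertices are pairwise distinct. *)
Record request (R : realType) (V : finType) (E : {set V * V}) := Request {
  source : V;
  walk : seq V;
  cost : R;
  walk_path : path (fun u v => (u, v) \in E) source walk;
  walk_simple : uniq (source :: walk);
  cost_gt0 : 0 < cost
}.

Section AdmissionControl.

Variables (R : realType) (V : finType) (E : {set V * V}) (cap : V * V -> nat).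

Notation request := (request R E).

Implicit Types (r : request) (s past : seq request).

Definition path_edges r : seq (V * V) := pairmap pair (source r) (walk r).

(* A set of accepted requests of [s] is encoded by a bit sequence [b] of size
   [size s]: the i-th request is accepted iff the i-th bit is set. *)
Definition feasible s (b : bitseq) : bool :=
  [forall e in E, count (fun r => e \in path_edges r) (mask b s) <= cap e]%N.

Definition rejection_cost s (b : bitseq) : R :=
  \sum_(r <- mask (map negb b) s) cost r.

(* The default argument of [arg min], rejecting everything, is feasible, so this
   is the minimum over all feasible solutions. *)
Definition opt_cost s : R :=
  rejection_cost s
    [arg min_(b < [tuple of nseq (size s) false] | feasible s b)
       rejection_cost s b]%O.

(* [new] may reject requests accepted in [old] (preemption), and may accept or
   reject the request that just arrived (the last bit), but accepts no request
   already rejected in [old]. *)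
Definition no_reacceptance (old new : bitseq) : Prop :=
  forall i, nth false new i -> nth false (rcons old true) i.

(* A randomized online algorithm in behavioral form: [decision past hist r] is
   the probability distribution of the set of accepted requests just after the
   arrival of [r], given the sequence [past] of the requests that arrived before
   [r] and the list [hist] of the accepted sets that the algorithm held after
   each of these earlier arrivals.
   The laws are also required for unreachable values of [hist]; this is harmless
   since rejecting every request is always allowed. *)
Record online_algorithm := OnlineAlgorithm {
  decision : forall past, seq bitseq -> request ->
    (size past).+1.-tuple bool -> R;
  decision_ge0 : forall past hist r b, 0 <= @decision past hist r b;
  decision_sum1 : forall past hist r, \sum_b @decision past hist r b = 1;
  decision_feasible : forall past hist r b,
    @decision past hist r b != 0 -> feasible (rcons past r) b;
  decision_irrevocable : forall past hist r b,
    @decision past hist r b != 0 -> no_reacceptance (last [::] hist) b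
}.

(* Expected total cost of the requests of [past ++ future] that are finally
   rejected (upon arrival or by preemption), conditionally on [hist]. *)
Fixpoint expected_cost_from (A : online_algorithm)
    past (hist : seq bitseq) (future : seq request) : R :=
  if future is r :: future' then
    \sum_b @decision A past hist r b *
      expected_cost_from A (rcons past r) (rcons hist b) future'
  else rejection_cost past (last [::] hist).

Definition expected_cost (A : online_algorithm) s : R :=
  expected_cost_from A [::] [::] s.

(* The request sequence is fixed in advance (oblivious adversary). *)
Definition competitive (beta : R) (A : online_algorithm) : Prop :=
  forall s, expected_cost A s <= beta * opt_cost s.

End AdmissionControl.

(* Main.v *)
Require Import Defs.
From HB Require Import structures.
From mathcomp Require Import all_boot all_order all_algebra.
From mathcomp Require Import all_classical all_reals all_analysis.
From mathcomp Require Import ring lra zify.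

(* The loads [Y i] of the requests solve the fractional problem online: while
   some edge [e] violates [sum_(i through e) (1 - g i) <= cap e], where
   [g i = min 1 ((exp (kappa Y i / p i) - 1) / (K + 1))], all requests through
   [e] with [Y i < p i] receive the same small extra load [eta].  If [e] has
   [cap e + n] such requests, the fractional cost grows by at most
   [4 kappa eta n], while any feasible solution rejects at least [n] of them;
   since [Y i <= 2 p i], the fractional cost is at most [8 kappa OPT].

   For rounding, request [i] survives with probability
   [S i = max 0 (1 - 2 ln lam g i)], [lam] being about [#|E|], through
   independent thinnings by the ratios of successive values of [S].  An
   exponential moment bounds by [1 / lam] the probability that a given edge is
   overfull after an arrival.  Then some surviving request through [e] costs no
   more than the increase of the single-edge optimum of [e], so repairing by
   preemption costs at most [1 / lam * OPT] per edge in total. *)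

Set Implicit Arguments.
Unset Strict Implicit.
Unset Printing Implicit Defensive.

Import Order.TTheory GRing.Theory Num.Theory.
Import numFieldNormedType.Exports.

Local Open Scope classical_set_scope.
Local Open Scope ring_scope.

(** * The exponential rejected fraction of a single request *)

Section Fractional.
Variables (R : realType) (K : nat).
Implicit Types p y eta : R.

Definition kappa : R := ln K.+2%:R.

(** Multiplicative-weights profile: since [expR kappa = K + 2], the exponential branch goes from 0
    at [y = 0] to 1 exactly at [y = p]. *)
Definition rejected_fraction p y : R :=
  Num.min 1 ((expR (kappa * (y / p)) - 1) / K.+1%:R).

Lemma kappa_gt0 : 0 < kappa.
Proof. by rewrite ln_gt0 // ltr1n. Qed.

Lemma rejected_fraction_le1 p y : rejected_fraction p y <= 1.
Proof. by rewrite /rejected_fraction ge_min lexx. Qed.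

Lemma rejected_fraction0 p : rejected_fraction p 0 = 0.
Proof.
by rewrite /rejected_fraction mul0r mulr0 expR0 subrr mul0r; apply/min_idPr.
Qed.

Lemma le_rejected_fraction p y y' : 0 <= p -> y <= y' ->
  rejected_fraction p y <= rejected_fraction p y'.
Proof.
move=> p0 yy'; rewrite /rejected_fraction le_min ge_min lexx /= ge_min.
rewrite ler_pM2r ?invr_gt0 ?ltr0Sn// lerD2r ler_expR.
by rewrite ler_wpM2l ?orbT ?(ltW kappa_gt0)// ler_wpM2r ?invr_ge0.
Qed.

Lemma rejected_fraction_ge0 p y : 0 <= p -> 0 <= y -> 0 <= rejected_fraction p y.
Proof.
by move=> p0 y0; rewrite -(rejected_fraction0 p) le_rejected_fraction.
Qed.

Lemma saturated_expR : expR kappa - 1 = K.+1%:R.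
Proof.
rewrite /kappa lnK ?posrE ?ltr0Sn//.
by rewrite -addn1 natrD addrK.
Qed.

Lemma rejected_fraction_saturated p y : 0 < p -> p <= y ->
  rejected_fraction p y = 1.
Proof.
move=> p0 py; apply/min_idPl.
rewrite ler_pdivlMr ?ltr0Sn// mul1r -saturated_expR lerD2r ler_expR.
by rewrite ler_peMr ?(ltW kappa_gt0)// ler_pdivlMr// mul1r.
Qed.

Lemma rejected_fraction_unsaturated p y : 0 < p -> y < p ->
  rejected_fraction p y = (expR (kappa * (y / p)) - 1) / K.+1%:R.
Proof.
move=> p0 py; apply/min_idPr/ltW.
rewrite ltr_pdivrMr ?ltr0Sn// mul1r -saturated_expR ltrD2r ltr_expR.
by rewrite gtr_pMr ?kappa_gt0// ltr_pdivrMr// mul1r.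
Qed.

Lemma expR_sub1_le (x : R) : 0 <= x -> x <= 1 / 2 -> expR x - 1 <= 2 * x.
Proof.
move=> x0 x12.
have h : 1 - x <= expR (- x) by have := expR_ge1Dx (- x).
have e0 := expR_gt0 x.
have : (1 - x) * expR x <= 1.
  by rewrite -[leRHS](expR0 R) -(addNr x) expRD ler_pM2r.
move=> h1; nra.
Qed.

(** Below saturation the fraction [g] solves [p * g' = kappa * (g + 1 / (K + 1))]. The bound on
    [eta] keeps the exponent increment below [1/2], so a finite step loses at most a factor 2. *)
Lemma rejected_fraction_step p y eta : 0 < p -> y < p -> 0 <= eta ->
  2 * kappa * eta <= p ->
  p * (rejected_fraction p (y + eta) - rejected_fraction p y) <=
  2 * kappa * eta * (rejected_fraction p y + K.+1%:R^-1).
Proof.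
move=> p0 yp eta0 etap.
rewrite [X in _ - X]rejected_fraction_unsaturated//.
rewrite [X in _ <= _ * (X + _)]rejected_fraction_unsaturated//.
set x := kappa * (eta / p); set u := expR _; set k := K.+1%:R.
have k0 : 0 < k^-1 :> R by rewrite invr_gt0 ltr0Sn.
have x0 : 0 <= x.
  by rewrite mulr_ge0 ?(ltW kappa_gt0)// divr_ge0 ?(ltW p0).
have x12 : x <= 1 / 2.
  by rewrite /x mulrA ler_pdivrMr//; lra.
have pin : p * x = kappa * eta.
  by rewrite /x mulrCA [p * _]mulrC divfK ?gt_eqF.
have le1 : rejected_fraction p (y + eta) <= (u * expR x - 1) / k.
  rewrite /rejected_fraction ge_min; apply/orP; right.
  by rewrite [(y + eta) / p]mulrDl mulrDr expRD.
have u0 : 0 < u by exact: expR_gt0.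
have := expR_sub1_le x0 x12.
set v := expR x in le1 * => vx.
apply: (@le_trans _ _ (p * ((u * v - 1) / k - (u - 1) / k))).
  by rewrite ler_pM2l// lerD2r.
have -> : (u * v - 1) / k - (u - 1) / k = (u * (v - 1)) / k.
  by rewrite -mulrBl; congr (_ / _); lra.
have -> : (u - 1) / k + k^-1 = u / k.
  by rewrite -[X in _ + X]mul1r -mulrDl; congr (_ / _); lra.
rewrite !mulrA ler_pM2r//.
have -> : 2 * kappa * eta * u = (p * u) * (2 * x).
  by rewrite -[2 * _ * eta]mulrA -pin; lra.
by rewrite ler_pM2l// mulr_gt0.
Qed.

End Fractional.

(** * Raising loads: the fractional online solution *)

Section Raise.
Variables (R : realType) (K N : nat) (T : Type) (P : T -> Prop).
Variables (A : T -> nat -> bool) (cap : T -> nat) (p : nat -> R).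
Hypothesis capK : forall e, P e -> (cap e <= K)%N.
Hypothesis p_gt0 : forall i, (i < N)%N -> 0 < p i.
Implicit Types (Y : nat -> R) (b : nat -> bool) (e : T) (eta : R).

Local Notation kappa := (kappa R K).
Local Notation g Y i := (rejected_fraction K (p i) (Y i)).

Definition covering Y := forall e, P e ->
  \sum_(i < N | A e i) (1 - g Y i) <= (cap e)%:R.

(** Quantifying over every feasible [b], rather than fixing an optimal one, lets the invariant
    survive further arrivals, which may change the optimum. *)
Definition charged Y := forall b,
  (forall e, P e -> (\sum_(i < N) (A e i && b i) <= cap e)%N) ->
  \sum_(i < N) p i * g Y i <= 4 * kappa * \sum_(i < N) (~~ b i)%:R * Y i.

Definition raise eta e Y : nat -> R :=
  fun i => if [&& (i < N)%N, A e i & Y i < p i] then Y i + eta else Y i.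

Lemma charged_raise eta e Y : P e -> 0 <= eta -> (forall i, 0 <= Y i) ->
  (forall i, (i < N)%N -> 2 * kappa * eta <= p i) ->
  charged Y -> (cap e)%:R < \sum_(i < N | A e i) (1 - g Y i) ->
  charged (raise eta e Y).
Proof.
move=> Pe eta0 Y0 etap cY viol b fb.
set S := fun i : 'I_N => A e i && (Y i < p i).
have k0 : 0 < kappa by exact: kappa_gt0.
have Y'E (i : 'I_N) : raise eta e Y i = Y i + (if S i then eta else 0).
  by rewrite /raise ltn_ord /= -/(S i); case: (S i); rewrite ?addr0.
have -> : \sum_(i < N) (~~ b i)%:R * raise eta e Y i =
   \sum_(i < N) (~~ b i)%:R * Y i + eta * \sum_(i < N | S i) (~~ b i)%:R.
  rewrite [X in _ = _ + X]mulr_sumr [X in _ = _ + X]big_mkcond -big_split/=.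
  apply: eq_bigr => i _.
  by rewrite Y'E mulrDr; case: ifP; rewrite ?mulr0// [eta * _]mulrC.
(* Saturated requests are fully rejected, so the violation comes from [S] alone. *)
have gS : \sum_(i < N | A e i) (1 - g Y i) = \sum_(i < N | S i) (1 - g Y i).
  rewrite big_mkcond [RHS]big_mkcond/=; apply: eq_bigr => i _; rewrite /S.
  case: (A e i) => //=; case: ltP => // pY.
  by rewrite rejected_fraction_saturated ?p_gt0// subrr.
rewrite gS in viol.
set s := #|[pred i | S i]|.
have sE : \sum_(i < N | S i) (1 : R) = s%:R.
  by rewrite sumr_const.
rewrite sumrB sE in viol.
set G := \sum_(i < N | S i) g Y i in viol.
have G0 : 0 <= G.
  apply: sumr_ge0 => i _; apply: rejected_fraction_ge0 => //.
  exact/ltW/p_gt0.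
have [n sn] : exists n, s = (cap e + n.+1)%N.
  have : (cap e < s)%N by rewrite -(ltr_nat R); lra.
  by move=> cs; exists (s - cap e).-1; rewrite prednK ?subn_gt0// subnKC// ltnW.
(* At most [cap e] of the [cap e + n.+1] requests in [S] are accepted by [b]. *)
have rej : n.+1%:R <= \sum_(i < N | S i) (~~ b i)%:R :> R.
  rewrite -(lerD2l (cap e)%:R) -natrD -sn -sE.
  apply: (@le_trans _ _ (\sum_(i < N | S i) (b i)%:R + \sum_(i < N | S i) (~~ b i)%:R)).
    by rewrite -big_split/=; apply: ler_sum => i _; case: (b i); rewrite ?addr0 ?add0r.
  rewrite lerD2r -natr_sum ler_nat; apply: leq_trans (fb _ Pe).
  rewrite big_mkcond/=; apply: leq_sum => i _.
  by rewrite /S; case: (A e i); case: (b i) => //=; case: ifP.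
(* [s <= K + n.+1 <= K.+1 * n.+1]: this is why the additive term in the fraction is
   [1 / (K + 1)]. *)
have sK : s%:R / K.+1%:R <= n.+1%:R :> R.
  rewrite ler_pdivrMr ?ltr0Sn// -natrM ler_nat sn mulSn mulnS.
  by have := capK Pe; have := leq0n (n * K); lia.
have gsum : \sum_(i < N) p i * g (raise eta e Y) i <= \sum_(i < N) p i * g Y i +
    2 * kappa * eta * (G + s%:R / K.+1%:R).
  rewrite -sE mulr_suml -big_split/= mulr_sumr [X in _ + X]big_mkcond -big_split/=.
  apply: ler_sum => i _; rewrite Y'E;
  case: ifP => [/andP[_ Yp]|_]; last by rewrite !addr0.
  rewrite -lerBlDl -mulrBr mul1r.
  by rewrite rejected_fraction_step ?p_gt0 ?etap.
have {cY} := cY b fb.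
(* Violation says [cap e < s - G]. With [sK], the cost grows by at most [2 * kappa * eta] times
   [2 * n.+1], hence the constant 4. *)
have GS : G <= n.+1%:R by move: viol; rewrite sn natrD; lra.
have ke : 0 <= 2 * kappa * eta by rewrite !mulr_ge0// ltW.
have := ler_wpM2l ke (lerD GS sK).
have := ler_wpM2l ke rej.
set Q := \sum_(i < N) _ * Y i; set W := \sum_(i < N | S i) _.
have <- : 4 * kappa * Q + 2 * (2 * kappa * eta * W) = 4 * kappa * (Q + eta * W) :> R.
  by rewrite mulrDr !mulrA -natrM.
move=> h1 h2 h3; apply: (le_trans gsum); apply: lerD h3 _.
by apply: (le_trans h2); rewrite mulrDr [2 * (_ * W)]mulr_natl mulr2n; exact: lerD.
Qed.

(* The total load is bounded and each raise adds at least [eta] to it, so raising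
   violated edges terminates. *)
Lemma exists_covering Y : (forall i, 0 <= Y i) ->
  (forall i, (i < N)%N -> Y i <= 2 * p i) -> charged Y ->
  exists Y', [/\ forall i, Y i <= Y' i, forall i, (N <= i)%N -> Y' i = Y i,
    forall i, (i < N)%N -> Y' i <= 2 * p i, charged Y' & covering Y'].
Proof.
have k0 : 0 < kappa by exact: kappa_gt0.
have [eta eta0 etap] : exists2 eta : R, 0 < eta &
    forall i, (i < N)%N -> 2 * kappa * eta <= p i /\ eta <= p i.
  (* A positive lower bound on all [p i], also meaningful for [N = 0]; it provides one step size for
     all requests. *)
  pose q : R := \prod_(i < N) Num.min 1 (p i).
  have q_gt0 : 0 < q.
    by apply: prodr_gt0 => i _; rewrite lt_min ltr01 p_gt0.
  have qp i : (i < N)%N -> q <= p i.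
    move=> iN; rewrite /q (bigD1 (Ordinal iN))//=.
    apply: (@le_trans _ _ (Num.min 1 (p i))); last by rewrite ge_min lexx orbT.
    have m0 j : (j < N)%N -> 0 <= Num.min 1 (p j).
      by move=> jN; rewrite le_min ler01 ltW// p_gt0.
    rewrite ler_piMr ?m0//; apply: prodr_ile1 => j _.
    by rewrite m0//= ge_min lexx.
  have k1 : 0 < 2 * kappa + 1 by lra.
  exists (q / (2 * kappa + 1)); first by rewrite divr_gt0.
  move=> i /qp qpi; split.
    rewrite mulrA ler_pdivrMr//; nra.
  rewrite ler_pdivrMr//; nra.
move=> Y0 Yp cY.
have [B hB] : exists B : nat, \sum_(i < N) (2 * p i - Y i) <= B%:R * eta.
  have := archi_boundP (x := (\sum_(i < N) (2 * p i - Y i)) / eta).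
  set x := _ / eta => hx; exists (Num.bound x).
  rewrite -ler_pdivrMr// -/x; apply/ltW/hx.
  apply: divr_ge0 (ltW eta0); apply: sumr_ge0 => i _.
  by rewrite subr_ge0 Yp.
elim: B Y Y0 Yp cY hB => [|B IH] Y Y0 Yp cY hB.
all: have [cov|/existsNP[e /not_implyP[Pe]]] := pselect (covering Y); first by exists Y.
all: move=> /negP; rewrite -ltNge => viol.
(* If all requests through [e] were saturated, the violated sum would be 0. For [B = 0] such an [i0]
   already contradicts [hB]. *)
all: have [i0 /andP[Ai0 Yi0]] : exists i : 'I_N, A e i && (Y i < p i).
1,3: apply/existsP; apply: contraT => /existsPn sat.
1,2: suff E : \sum_(i < N | A e i) (1 - g Y i) = 0 by move: viol; rewrite E ltNge ler0n.
1,2: by apply: big1 => i Ai; rewrite rejected_fraction_saturated ?p_gt0 ?subrr//;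
  move: (sat i); rewrite Ai /= -leNgt.
  exfalso; move: hB; rewrite mul0r leNgt => /negP; apply.
  rewrite (bigD1 i0)//= ltr_wpDr//.
    by apply: sumr_ge0 => i _; rewrite subr_ge0 Yp.
  by rewrite subr_gt0 (lt_le_trans Yi0)//; have := p_gt0 (ltn_ord i0); lra.
have le i : Y i <= raise eta e Y i.
  by rewrite /raise; case: ifP => // _; rewrite lerDl ltW.
have [||||Y' [Y'1 Y'2 Y'3 Y'4 Y'5]] := IH (raise eta e Y).
- by move=> i; exact: le_trans (le i).
- move=> i iN; rewrite /raise; case: ifP => [/and3P[_ _ Yi]|_]; last exact: Yp.
  by have [_] := etap _ iN; lra.
- by apply: charged_raise => //; [exact: ltW|move=> i /etap[]].
- move: hB; rewrite (bigD1 i0)//= [X in _ -> X <= _](bigD1 i0)//= -natr1 mulrDl mul1r.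
  rewrite {1}/raise ltn_ord Ai0 Yi0/=.
  have : \sum_(i < N | i != i0) (2 * p i - raise eta e Y i) <=
         \sum_(i < N | i != i0) (2 * p i - Y i).
    by apply: ler_sum => i _; rewrite lerD2l lerN2.
  lra.
exists Y'; split => //.
  by move=> i; exact: le_trans (Y'1 i).
by move=> i Ni; rewrite Y'2// /raise ltnNge Ni.
Qed.

End Raise.

(** * Costs and usages by index; the single-edge optimum *)

Section Bits.
Variables (R : realType) (V : finType) (E : {set V * V}) (cap : V * V -> nat).
Notation request := (request R E).
Implicit Types (r : request) (s : seq request) (b z : bitseq) (e : V * V).

(** Total functions of a natural index keep the same type when a request is appended. *)
Definition price s i : R := nth 0 (map (@cost R V E) s) i.

Definition crosses s e i : bool :=
  nth false (map (fun r => e \in path_edges r) s) i.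

Definition usage s e b : nat := \sum_(i < size s) (crosses s e i && nth false b i).

Definition rejected_price s b : R :=
  \sum_(i < size s) price s i * (~~ nth false b i)%:R.

Lemma price_rcons s r i : (i < size s)%N -> price (rcons s r) i = price s i.
Proof. by move=> si; rewrite /price map_rcons nth_rcons size_map si. Qed.

Lemma price_last s r : price (rcons s r) (size s) = cost r.
Proof. by rewrite /price map_rcons nth_rcons size_map ltnn eqxx. Qed.

Lemma crosses_rcons s r e i : (i < size s)%N ->
  crosses (rcons s r) e i = crosses s e i.
Proof. by move=> si; rewrite /crosses map_rcons nth_rcons size_map si. Qed.

Lemma price_gt0 s i : (i < size s)%N -> 0 < price s i.
Proof.
elim: s i => [|r s IH] [|i]//=; rewrite /price/= => si; first exact: cost_gt0.
exact: IH.
Qed.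

Lemma price_out s i : (size s <= i)%N -> price s i = 0.
Proof. by move=> si; rewrite /price nth_default// size_map. Qed.

Lemma price_ge0 s i : 0 <= price s i.
Proof. by case: (ltnP i (size s)) => [/price_gt0/ltW|/price_out ->]. Qed.

Lemma count_mask (T : Type) (a : pred T) (t : seq T) b :
  count a (mask b t) = (\sum_(i < size t) (nth false (map a t) i && nth false b i))%N.
Proof.
elim: t b => [|x t IH] [|y b]; rewrite ?big_ord0 ?mask0//=.
  by rewrite big1// => i _; rewrite nth_nil andbF.
rewrite big_ord_recl/= -IH; case: y => //=.
  by rewrite andbT.
by rewrite andbF.
Qed.

Lemma feasibleE s b :
  feasible cap s b = [forall e in E, (usage s e b <= cap e)%N].
Proof. by apply: eq_forallb => e; rewrite count_mask. Qed.

Lemma rejection_costE s b : size b = size s ->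
  rejection_cost s b = rejected_price s b.
Proof.
rewrite /rejection_cost /rejected_price /price.
elim: s b => [|x s IH] [|y b]//=; first by rewrite big_ord0 big_nil.
move=> [/IH bs]; rewrite big_ord_recl/=; case: y => /=.
  by rewrite bs mulr0 add0r.
by rewrite big_cons bs mulr1.
Qed.

Lemma usage_rcons s r e b : usage (rcons s r) e b =
  (usage s e b + (crosses (rcons s r) e (size s) && nth false b (size s)))%N.
Proof.
rewrite /usage size_rcons big_ord_recr/=; congr (_ + _)%N.
by apply: eq_bigr => i _; rewrite crosses_rcons.
Qed.

Lemma rejected_price_rcons s r b : rejected_price (rcons s r) b =
  rejected_price s b + cost r * (~~ nth false b (size s))%:R.
Proof.
rewrite /rejected_price size_rcons big_ord_recr/= price_last; congr (_ + _).
by apply: eq_bigr => i _; rewrite price_rcons.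
Qed.

Lemma rejected_price_ge0 s b : 0 <= rejected_price s b.
Proof. by apply: sumr_ge0 => i _; rewrite mulr_ge0// price_ge0. Qed.

Lemma usage_eq s e b z :
  (forall i, (i < size s)%N -> nth false b i = nth false z i) ->
  usage s e b = usage s e z.
Proof. by move=> bz; apply: eq_bigr => i _; rewrite bz. Qed.

Lemma usage_nseq s e n : usage s e (nseq n false) = 0%N.
Proof. by apply: big1 => i _; rewrite nth_nseq if_same andbF. Qed.

Lemma feasible_nseq s n : feasible cap s (nseq n false).
Proof. by rewrite feasibleE; apply/forall_inP => e _; rewrite usage_nseq. Qed.

(** The relaxation that enforces only the capacity of [e]: a lower bound on [opt_cost] whose
    increments along the arrivals telescope. *)
Definition edge_opt s e : R := rejected_price s
  [arg min_(b < [tuple of nseq (size s) false] | (usage s e b <= cap e)%N)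
    rejected_price s b]%O.

Lemma edge_opt_le s e b : (usage s e b <= cap e)%N ->
  edge_opt s e <= rejected_price s b.
Proof.
move=> be; rewrite /edge_opt; case: arg_minP => [|t _ tmin].
  by rewrite usage_nseq.
pose b' := [tuple nth false b i | i < size s].
have bb0 i : (i < size s)%N -> nth false b' i = nth false b i.
  move=> si.
  by rewrite -(nth_mktuple (fun j : 'I_(size s) => nth false b j) false (Ordinal si)).
rewrite (le_trans (tmin b' _))//; first by rewrite (usage_eq _ bb0).
by rewrite le_eqVlt; apply/orP/or_introl/eqP/eq_bigr => i _; rewrite bb0.
Qed.

Lemma edge_opt_ex s e :
  exists2 b, (usage s e b <= cap e)%N & edge_opt s e = rejected_price s b.
Proof.
rewrite /edge_opt; case: arg_minP => [|t te _]; last by exists t.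
by rewrite usage_nseq.
Qed.

Lemma opt_cost_ex s : exists b : bitseq,
  [/\ size b = size s, feasible cap s b & opt_cost cap s = rejected_price s b].
Proof.
rewrite /opt_cost; case: arg_minP => [|t ts _]; first exact: feasible_nseq.
by exists t; rewrite ?size_tuple ?rejection_costE ?size_tuple.
Qed.

Lemma edge_opt_le_opt_cost s e : e \in E -> edge_opt s e <= opt_cost cap s.
Proof.
have [b [_ + ->]] := opt_cost_ex s.
by rewrite feasibleE => /forall_inP/[apply]; exact: edge_opt_le.
Qed.

Lemma edge_opt_ge0 s e : 0 <= edge_opt s e.
Proof. exact: rejected_price_ge0. Qed.

Lemma edge_opt_rcons s r e : edge_opt s e <= edge_opt (rcons s r) e.
Proof.
have [b + ->] := edge_opt_ex (rcons s r) e.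
rewrite usage_rcons rejected_price_rcons => /(leq_trans (leq_addr _ _)) be.
rewrite (le_trans (edge_opt_le be))// lerDl mulr_ge0// ltW//; exact: cost_gt0.
Qed.

(** Overfilling forces [r] to cross [e] and [z] to use [cap e] fully on [s]. Let [b] be optimal for
    [e] on [rcons s r]. If [b] accepts [r], it misses an old [i] chosen by [z], and giving [i] the
    place of [r] yields a solution for [s]; if [b] rejects [r], then [r] itself is the witness. *)
Lemma edge_opt_exchange s r e z : (usage s e z <= cap e)%N ->
  (cap e < usage (rcons s r) e z)%N ->
  exists i : 'I_(size s).+1, [/\ crosses (rcons s r) e i, nth false z i &
    price (rcons s r) i <= edge_opt (rcons s r) e - edge_opt s e].
Proof.
move=> ze; rewrite usage_rcons.
case: (boolP (crosses _ _ _ && _)) => [/andP[cr zr]|_]; last by rewrite addn0 ltnNge ze.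
rewrite addn1 ltnS => ez.
have [b + ->] := edge_opt_ex (rcons s r) e.
rewrite usage_rcons rejected_price_rcons cr/=.
case: (boolP (nth false b (size s))) => br be.
  have [i /and3P[ci zi bi]] : exists i : 'I_(size s),
      [&& crosses s e i, nth false z i & ~~ nth false b i].
    apply/existsP; apply: contraLR be => /existsPn h; rewrite -ltnNge addn1 ltnS.
    apply: (leq_trans ez); apply: leq_sum => i _; move: (h i).
    by case: crosses; case: nth; case: nth.
  exists (widen_ord (leqnSn _) i); rewrite /= crosses_rcons// price_rcons//; split => //.
  pose b' := set_nth false b i true.
  have nb' (j : 'I_(size s)) : nth false b' j = (j == i) || nth false b j.
    by rewrite nth_set_nth /= -val_eqE; case: eqP.
  have ub' : (usage s e b' <= cap e)%N.
    apply: leq_trans be; rewrite /usage (bigD1 i)//= [X in (_ <= X + _)%N](bigD1 i)//=.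
    rewrite (negbTE bi) andbF add0n addnC leq_add ?leq_b1//.
    by apply: leq_sum => j /negbTE ji; rewrite nb' ji.
  rewrite lerBrDr mulr0 addr0 -lerBrDl (le_trans (edge_opt_le ub'))// lerBrDl.
  rewrite /rejected_price (bigD1 i)//= [leRHS](bigD1 i)//= nb' eqxx/= mulr0 add0r bi mulr1.
  by rewrite lerD2l; apply: ler_sum => j /negbTE ji; rewrite nb' ji.
exists ord_max; split => //=.
rewrite price_last mulr1 lerBrDr addrC lerD2r; apply: edge_opt_le.
exact: leq_trans (leq_addr _ _) be.
Qed.

End Bits.

(** * Randomized rounding by thinning and repair *)

Section Rounding.
Variables (R : realType) (V : finType) (E : {set V * V}) (cap : V * V -> nat).
Notation request := (request R E).
Variable S : seq request -> nat -> R.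
Hypothesis S_ge0 : forall s i, 0 <= S s i.
Hypothesis S_out : forall s i, (size s <= i)%N -> S s i = 1.
Hypothesis S_rcons : forall s r i, S (rcons s r) i <= S s i.
Implicit Types (r : request) (s past future : seq request) (old : bitseq).
Implicit Types (mu : nat -> R) (g h : bitseq -> R).

(** Conditional survival probability. When [S past i = 0] the quotient is 0 by convention, which is
    consistent because [S] never increases. *)
Definition keep past r i : R := S (rcons past r) i / S past i.

Lemma keepM past r i : S past i * keep past r i = S (rcons past r) i.
Proof.
rewrite /keep; have [S0|/eqP S0] := eqVneq (S past i) 0; last first.
  by rewrite mulrCA divff ?mulr1//; exact/eqP.
rewrite S0 mul0r; apply/eqP; rewrite eq_le S_ge0 -S0.
by rewrite S_rcons.
Qed.

Lemma keep_ge0 past r i : 0 <= keep past r i.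
Proof. exact: divr_ge0. Qed.

Lemma keep_le1 past r i : keep past r i <= 1.
Proof.
rewrite /keep; have [->|S0] := eqVneq (S past i) 0; first by rewrite invr0 mulr0.
by rewrite ler_pdivrMr ?mul1r// lt_neqAle eq_sym S0 S_ge0.
Qed.

Lemma keep_out past r i : (size past <= i)%N -> keep past r i = S (rcons past r) i.
Proof. by move=> si; rewrite /keep (S_out si) divr1. Qed.

Definition coin_prob past r (X : {ffun 'I_(size past).+1 -> bool}) : R :=
  \prod_(i < (size past).+1) (if X i then keep past r i else 1 - keep past r i).

Lemma coin_prob_ge0 past r X : 0 <= coin_prob (past := past) r X.
Proof.
apply: prodr_ge0 => i _; case: ifP => _; first exact: keep_ge0.
by rewrite subr_ge0 keep_le1.
Qed.

Lemma coin_prob_prod past r (f : 'I_(size past).+1 -> bool -> R) :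
  \sum_X coin_prob r X * \prod_(i < (size past).+1) f i (X i) =
  \prod_(i < (size past).+1) (keep past r i * f i true + (1 - keep past r i) * f i false).
Proof.
transitivity (\prod_(i < (size past).+1) \sum_(x : bool)
    (if x then keep past r i else 1 - keep past r i) * f i x).
  rewrite bigA_distr_bigA/=; apply: eq_bigr => X _.
  by rewrite /coin_prob -big_split.
by apply: eq_bigr => i _; rewrite big_bool.
Qed.

Lemma coin_prob_sum1 past r : \sum_X coin_prob (past := past) r X = 1.
Proof.
have := coin_prob_prod r (fun (_ : 'I_(size past).+1) _ => 1).
under eq_bigr do rewrite big1// mulr1.
by move=> ->; apply: big1 => i _; rewrite !mulr1 addrC subrK.
Qed.

Lemma coin_prob_marginal past r i :
  \sum_X coin_prob (past := past) r X * (X i)%:R = keep past r i.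
Proof.
have := coin_prob_prod r (fun (j : 'I_(size past).+1) x => if j == i then x%:R else 1).
rewrite [RHS](bigD1 i)//= eqxx mulr1 mulr0 addr0 [X in _ * X]big1 => [|j /negbTE ->].
  rewrite mulr1 => <-; apply: eq_bigr => X _; congr (_ * _).
  rewrite (bigD1 i)//= eqxx big1 ?mulr1// => j /negbTE -> //.
by rewrite !mulr1 addrC subrK.
Qed.

(** The appended [true] admits the arriving request tentatively; its own coin then decides. *)
Definition thinned n old (X : {ffun 'I_n -> bool}) : n.-tuple bool :=
  [tuple nth false (rcons old true) i && X i | i < n].

Definition repaired past r (z : (size past).+1.-tuple bool) :
    (size past).+1.-tuple bool :=
  [arg min_(b < [tuple of nseq (size past).+1 false] |
       feasible cap (rcons past r) b && [forall i, tnth b i ==> tnth z i])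
     rejection_cost (rcons past r) b]%O.

Lemma nth_thinned n old (X : {ffun 'I_n -> bool}) (i : 'I_n) :
  nth false (thinned old X) i = nth false (rcons old true) i && X i.
Proof. by rewrite nth_mktuple. Qed.

Lemma repairedP past r (z : (size past).+1.-tuple bool) :
  [/\ feasible cap (rcons past r) (repaired r z),
    forall i, nth false (repaired r z) i -> nth false z i &
    forall b : (size past).+1.-tuple bool, feasible cap (rcons past r) b ->
      (forall i, tnth b i -> tnth z i) ->
      rejected_price (rcons past r) (repaired r z) <= rejected_price (rcons past r) b].
Proof.
rewrite /repaired; case: arg_minP => [|t /andP[tf /forallP tz] tmin].
  rewrite feasible_nseq; apply/forallP => i.
  have -> : tnth [tuple of nseq (size past).+1 false] i = false; last by [].
  rewrite (tnth_nth false) -[LHS]/(nth false (nseq (size past).+1 false) i).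
  by rewrite nth_nseq if_same.
split=> // [i ti|b bf bz].
  have [si|si] := ltnP i (size past).+1; last by rewrite nth_default ?size_tuple in ti.
  have := tz (Ordinal si); rewrite !(tnth_nth false)/= ti; exact: id.
rewrite -!rejection_costE ?size_rcons ?size_tuple//; apply: tmin.
by rewrite bf; apply/forallP => i; apply/implyP/bz.
Qed.

(** The image of the coin law under thinning followed by repair. *)
Definition rounding_decision past (hist : seq bitseq) r
    (b : (size past).+1.-tuple bool) : R :=
  \sum_X coin_prob r X * (b == repaired r (thinned (last [::] hist) X))%:R.

Definition round_step past old r g : R :=
  \sum_X coin_prob (past := past) r X * g (repaired r (thinned old X)).

Lemma rounding_decisionE past hist r g :
  \sum_b rounding_decision (past := past) hist r b * g b =
  round_step past (last [::] hist) r g.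
Proof.
under eq_bigr do rewrite mulr_suml.
rewrite exchange_big; apply: eq_bigr => X _ /=.
rewrite (bigD1 (repaired r (thinned (last [::] hist) X)))//= eqxx mulr1 big1 ?addr0//.
by move=> b /negbTE ->; rewrite mulr0 mul0r.
Qed.

Lemma rounding_decision_ge0 past hist r b :
  0 <= rounding_decision (past := past) hist r b.
Proof. by apply: sumr_ge0 => X _; rewrite mulr_ge0 ?coin_prob_ge0. Qed.

Lemma rounding_decision_sum1 past hist r :
  \sum_b rounding_decision (past := past) hist r b = 1.
Proof.
have := rounding_decisionE past hist r (fun=> 1).
under eq_bigr do rewrite mulr1.
by move=> ->; rewrite /round_step -mulr_suml coin_prob_sum1 mul1r.
Qed.

Lemma rounding_decision_neq0 past hist r b :
  rounding_decision (past := past) hist r b != 0 ->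
  exists X, b = repaired r (thinned (last [::] hist) X).
Proof.
move=> h; apply/not_existsP => nX; move: h; rewrite /rounding_decision big1 ?eqxx// => X _.
by case: eqP => [/nX//|_]; rewrite mulr0.
Qed.

Lemma rounding_decision_feasible past hist r b :
  rounding_decision (past := past) hist r b != 0 -> feasible cap (rcons past r) b.
Proof.
by move=> /rounding_decision_neq0[X ->]; have [] := repairedP r (thinned (last [::] hist) X).
Qed.

Lemma rounding_decision_irrevocable past hist r b :
  rounding_decision (past := past) hist r b != 0 -> no_reacceptance (last [::] hist) b.
Proof.
move=> /rounding_decision_neq0[X ->] i.
have [_ /(_ i) + _] := repairedP r (thinned (last [::] hist) X) => /[apply].
have [si|si] := ltnP i (size past).+1; last by rewrite nth_default ?size_tuple.
by rewrite (nth_thinned _ _ (Ordinal si)) => /andP[].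
Qed.

Definition rounding_algorithm : online_algorithm R E cap :=
  OnlineAlgorithm rounding_decision_ge0 rounding_decision_sum1
    rounding_decision_feasible rounding_decision_irrevocable.

(** The accepted sets form a Markov chain, so the last one, [old], suffices as state. *)
Fixpoint expectation_from past old future g : R :=
  if future is r :: future' then
    round_step past old r (fun b => expectation_from (rcons past r) b future' g)
  else g old.

Definition expectation s g : R := expectation_from [::] [::] s g.

(** The recursion peels off the first arrival; peeling off the last one instead enables induction on
    the time elapsed. *)
Lemma expectation_rcons s r g :
  expectation (rcons s r) g = expectation s (fun b => round_step s b r g).
Proof.
suff H past old : expectation_from past old (rcons s r) g =
    expectation_from past old s (fun b => round_step (past ++ s) b r g) by exact: H.
elim: s past old => [|x s IH] past old /=; first by rewrite cats0.
by apply: eq_bigr => X _; rewrite IH cat_rcons.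
Qed.

Lemma expected_cost_rounding s :
  expected_cost rounding_algorithm s = expectation s (rejection_cost s).
Proof.
suff H past hist : expected_cost_from rounding_algorithm past hist s =
    expectation_from past (last [::] hist) s (rejection_cost (past ++ s)) by exact: H.
elim: s past hist => [|x s IH] past hist /=; first by rewrite cats0.
apply: etrans (rounding_decisionE past hist x (fun b =>
  expected_cost_from rounding_algorithm (rcons past x) (rcons hist b) s)) _.
apply: eq_bigr => X _.
by rewrite IH last_rcons cat_rcons.
Qed.

Lemma ler_expectation s g h :
  (forall b, size b = size s -> feasible cap s b -> g b <= h b) ->
  expectation s g <= expectation s h.
Proof.
elim/last_ind: s g h => [|s r IH] g h gh.
  by apply: gh => //; exact: (@feasible_nseq _ _ _ _ _ 0).
rewrite !expectation_rcons; apply: IH => b _ _.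
apply: ler_sum => X _; rewrite ler_wpM2l ?coin_prob_ge0// gh ?size_tuple ?size_rcons//.
by have [] := repairedP r (thinned b X).
Qed.

Lemma expectation_linear s (c : R) g h :
  expectation s (fun b => c * g b + h b) = c * expectation s g + expectation s h.
Proof.
rewrite /expectation; elim: s [::] [::] => //= r s IH past old.
rewrite /round_step mulr_sumr -big_split/=; apply: eq_bigr => X _.
by rewrite IH mulrDr mulrCA.
Qed.

Lemma expectation_cst s (c : R) : expectation s (fun=> c) = c.
Proof.
rewrite /expectation; elim: s [::] [::] => //= r s IH past old.
rewrite /round_step; under eq_bigr do rewrite IH.
by rewrite -mulr_suml coin_prob_sum1 mul1r.
Qed.

Lemma expectationD s g h :
  expectation s (fun b => g b + h b) = expectation s g + expectation s h.
Proof.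
rewrite -[X in X + _]mul1r -expectation_linear; congr expectation.
by apply/funext => b; rewrite mul1r.
Qed.

Lemma expectationZ s (c : R) g : expectation s (fun b => c * g b) = c * expectation s g.
Proof.
rewrite -[RHS]addr0 -(expectation_cst s 0) -expectation_linear; congr expectation.
by apply/funext => b; rewrite addr0.
Qed.

Lemma expectation_sum s (I : Type) (t : seq I) (Q : pred I) (g : I -> bitseq -> R) :
  expectation s (fun b => \sum_(i <- t | Q i) g i b) =
  \sum_(i <- t | Q i) expectation s (g i).
Proof.
elim: t => [|i t IH].
  rewrite big_nil -[RHS](expectation_cst s 0).
  by congr expectation; apply/funext => b; rewrite big_nil.
rewrite big_cons -IH; case: (boolP (Q i)) => Qi.
  by rewrite -expectationD; congr expectation; apply/funext => b; rewrite big_cons Qi.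
by congr expectation; apply/funext => b; rewrite big_cons (negbTE Qi).
Qed.

Lemma coin_prob_thinned s r old mu : size old = size s ->
  \sum_X coin_prob (past := s) r X *
    \prod_(i < (size s).+1) (1 + mu i * (nth false (thinned old X) i)%:R) =
  \prod_(i < size s) (1 + mu i * keep s r i * (nth false old i)%:R) *
  (1 + mu (size s) * S (rcons s r) (size s)).
Proof.
move=> so.
pose f (i : 'I_(size s).+1) (x : bool) : R :=
  1 + mu i * (nth false (rcons old true) i && x)%:R.
transitivity (\sum_X coin_prob r X * \prod_(i < (size s).+1) f i (X i)).
  apply: eq_bigr => X _; congr (_ * _); apply: eq_bigr => i _.
  by rewrite nth_thinned.
rewrite coin_prob_prod big_ord_recr/= /f /= nth_rcons so ltnn eqxx/=.
rewrite keep_out//; congr (_ * _); last by ring.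
apply: eq_bigr => i _; rewrite nth_rcons so ltn_ord.
by case: nth => /=; ring.
Qed.

(** The bound before the repair, with the case of [s] as a hypothesis: it serves both as the
    inductive step of [expectation_prod] and in [overfull_prob]. Averaging the coins replaces [mu i]
    by [mu i * keep s r i], and [keepM] turns [S s] into [S (rcons s r)]. *)
Lemma expectation_thinned s r mu :
  (forall nu : nat -> R, (forall i, 0 <= nu i) ->
    expectation s (fun b => \prod_(i < size s) (1 + nu i * (nth false b i)%:R)) <=
    \prod_(i < size s) (1 + nu i * S s i)) ->
  (forall i, 0 <= mu i) ->
  expectation s (fun b => \sum_X coin_prob (past := s) r X *
    \prod_(i < (size s).+1) (1 + mu i * (nth false (thinned b X) i)%:R)) <=
  \prod_(i < (size s).+1) (1 + mu i * S (rcons s r) i).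
Proof.
move=> IH mu0; rewrite big_ord_recr/=.
apply: (@le_trans _ _ (expectation s (fun b =>
  (1 + mu (size s) * S (rcons s r) (size s)) *
  \prod_(i < size s) (1 + mu i * keep s r i * (nth false b i)%:R)))).
  by apply: ler_expectation => b bs _; rewrite coin_prob_thinned// mulrC.
rewrite expectationZ mulrC ler_wpM2r ?addr_ge0 ?mulr_ge0//.
apply: (le_trans (IH (fun i => mu i * keep s r i) _)).
  by move=> i; rewrite mulr_ge0 ?keep_ge0.
apply: ler_prod => i _; rewrite -mulrA [keep _ _ _ * _]mulrC keepM lexx andbT.
by rewrite addr_ge0// mulr_ge0.
Qed.

(* The indicators of acceptance are negatively correlated; this survives the
   repair, which only rejects more. *)
Lemma expectation_prod s mu : (forall i, 0 <= mu i) ->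
  expectation s (fun b => \prod_(i < size s) (1 + mu i * (nth false b i)%:R)) <=
  \prod_(i < size s) (1 + mu i * S s i).
Proof.
elim/last_ind: s mu => [|s r IH] mu mu0.
  by rewrite big_ord0 /expectation/= big_ord0.
rewrite expectation_rcons size_rcons.
apply: le_trans _ (expectation_thinned r IH mu0).
apply: ler_expectation => b _ _; apply: ler_sum => X _.
rewrite ler_wpM2l ?coin_prob_ge0//; apply: ler_prod => i _.
rewrite addr_ge0 ?mulr_ge0//= lerD2l ler_wpM2l//.
have [_ /(_ i) + _] := repairedP r (thinned b X).
by case: nth => // ->.
Qed.

Lemma expectation_accepted s i : (i < size s)%N ->
  expectation s (fun b => (nth false b i)%:R) <= S s i.
Proof.
move=> si.
(* With weights concentrated at [i] both products reduce to one factor. *)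
have := @expectation_prod s (fun j => (j == i)%:R) (fun=> ler0n _ _).
have prodE (F : nat -> R) : \prod_(j < size s) (1 + (j == i :> nat)%:R * F j) = 1 + F i.
  rewrite (bigD1 (Ordinal si))//= eqxx mul1r big1 ?mulr1// => j.
  by rewrite -val_eqE/= => /negbTE ->; rewrite mul0r addr0.
rewrite (prodE (S s)).
under [X in expectation _ X]eq_fun do rewrite (prodE (fun i => (nth false _ i)%:R)).
by rewrite expectationD expectation_cst lerD2l.
Qed.

(** One arrival overfills an edge by at most one unit, so dropping for each overfull edge the
    request given by [edge_opt_exchange] restores feasibility; the cheapest repair costs no more. *)
Lemma repaired_price s r b (z : (size s).+1.-tuple bool) :
  feasible cap s b -> (forall i, (i < size s)%N -> nth false z i -> nth false b i) ->
  rejected_price (rcons s r) (repaired r z) <= rejected_price (rcons s r) z +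
  \sum_(e in E) (cap e < usage (rcons s r) e z)%N%:R *
    (edge_opt cap (rcons s r) e - edge_opt cap s e).
Proof.
move=> bf zb.
have zcap e : e \in E -> (usage s e z <= cap e)%N.
  move: bf; rewrite feasibleE => /forall_inP/[apply]; apply: leq_trans.
  apply: leq_sum => i _; case: crosses => //=.
  by have := zb i (ltn_ord i); case: nth => // ->.
have /choice[v vP] : forall e, exists i : 'I_(size s).+1, e \in E ->
    (cap e < usage (rcons s r) e z)%N ->
    [/\ crosses (rcons s r) e i, nth false z i &
    price (rcons s r) i <= edge_opt cap (rcons s r) e - edge_opt cap s e].
  move=> e.
  have [eE|] := boolP (e \in E); last by exists ord0.
  have [over|] := boolP (cap e < usage (rcons s r) e z)%N; last by exists ord0.
  by have [i iP] := edge_opt_exchange (zcap _ eE) over; exists i.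
pose over e := (e \in E) && (cap e < usage (rcons s r) e z)%N.
pose c := [tuple nth false z i && ~~ [exists e, over e && (v e == i)] | i < (size s).+1].
have cE (i : 'I_(size s).+1) : nth false c i =
    nth false z i && ~~ [exists e, over e && (v e == i)].
  by rewrite nth_mktuple.
have [_ _ /(_ c) le_c] := repairedP r z.
apply: (le_trans (le_c _ _)) => {le_c}.
- rewrite feasibleE; apply/forall_inP => e eE.
  have cz : (usage (rcons s r) e c <= usage (rcons s r) e z)%N.
    apply: leq_sum; rewrite size_rcons => i _.
    by rewrite cE; case: crosses => //=; case: nth => //=; exact: leq_b1.
  have [over_e|] := ltnP (cap e) (usage (rcons s r) e z); last exact: leq_trans cz.
  have [cv zv _] := vP _ eE over_e.
  rewrite -ltnS; apply: (@leq_trans (usage (rcons s r) e z)).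
    rewrite /usage size_rcons (bigD1 (v e))//= [X in (_ < X)%N](bigD1 (v e))//=.
    rewrite cv zv cE/= (_ : [exists _, _]) ?andbF ?add0n.
      rewrite add1n ltnS; apply: leq_sum => i _.
      by rewrite cE; case: crosses => //=; case: nth => //=; exact: leq_b1.
    by apply/existsP; exists e; rewrite /over eE over_e eqxx.
  rewrite usage_rcons (leq_trans (leq_add (zcap _ eE) (leq_b1 _)))// addn1.
  exact: leqnn.
- by move=> i; rewrite !(tnth_nth false) cE => /andP[].
rewrite /rejected_price size_rcons.
(* A request dropped for several edges is charged once per edge, an overcount in the right
   direction. *)
apply: (@le_trans _ _ (\sum_(i < (size s).+1) (price (rcons s r) i * (~~ nth false z i)%:R
  + \sum_(e | over e) (v e == i)%:R * price (rcons s r) i))).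
  apply: ler_sum => i _; rewrite cE negb_and negbK.
  have p0 := price_ge0 (rcons s r) i.
  have s0 : 0 <= \sum_(e | over e) (v e == i)%:R * price (rcons s r) i.
    by apply: sumr_ge0 => e _; rewrite mulr_ge0.
  case: (nth false z i) => /=; last by rewrite lerDl.
  rewrite mulr0 add0r; case: existsP => [[e /andP[oe ve]]|_]; last by rewrite mulr0.
  rewrite (bigD1 e)//= ve mul1r mulr1 lerDl; apply: sumr_ge0 => e' _.
  by rewrite mulr_ge0.
rewrite big_split/= lerD2l exchange_big/= big_mkcondr/=.
apply: ler_sum => e eE; case: ifP => oe; last by rewrite mul0r.
rewrite mul1r (bigD1 (v e))//= eqxx mul1r big1 ?addr0.
  by have [] := vP _ eE oe.
by move=> i; rewrite eq_sym => /negbTE ->; rewrite mul0r.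
Qed.

(** * Expected cost of the rounding *)

Section CompetitiveRatio.
Variable lam : R.
Hypothesis lam_ge1 : 1 <= lam.
Hypothesis S_cap : forall s e, e \in E ->
  \prod_(i < size s | crosses s e i) (1 + (lam - 1) * S s i) <= lam ^+ cap e.

(* Markov's inequality for [lam ^ usage]. *)
Lemma overfull_prob s r e : e \in E ->
  expectation s (fun b => \sum_X coin_prob (past := s) r X *
    (cap e < usage (rcons s r) e (thinned b X))%N%:R) <= lam^-1.
Proof.
move=> eE; have lam0 : 0 < lam by exact: lt_le_trans lam_ge1.
pose mu i : R := (crosses (rcons s r) e i)%:R * (lam - 1).
have mu0 i : 0 <= mu i by rewrite mulr_ge0// subr_ge0.
(* Overfull means usage at least [(cap e).+1], while [S_cap] bounds the moment by [lam ^+ cap e];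
   the quotient leaves [lam^-1]. *)
apply: (@le_trans _ _ (expectation s (fun b => lam ^- (cap e).+1 *
  \sum_X coin_prob (past := s) r X *
    \prod_(i < (size s).+1) (1 + mu i * (nth false (thinned b X) i)%:R)))).
  apply: ler_expectation => b _ _; rewrite mulr_sumr; apply: ler_sum => X _.
  rewrite mulrCA ler_wpM2l ?coin_prob_ge0//.
  have -> : \prod_(i < (size s).+1) (1 + mu i * (nth false (thinned b X) i)%:R) =
      lam ^+ usage (rcons s r) e (thinned b X).
    rewrite /usage size_rcons; elim/big_rec2: _ => [|i n x _ ->]; first by rewrite expr0.
    rewrite exprD /mu; case: (crosses (rcons s r) e i); case: nth => /=;
      rewrite ?mul1r ?mulr1 ?mulr0 ?mul0r ?addr0 ?expr0 ?expr1 ?mul1r//.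
    by rewrite addrC subrK.
  case: ltnP => [h|_]; last by rewrite mulr_ge0 ?invr_ge0 ?exprn_ge0// ltW.
  by rewrite mulrC ler_pdivlMr ?exprn_gt0// mul1r ler_weXn2l.
rewrite expectationZ mulrC ler_pdivrMr ?exprn_gt0// exprS mulKf ?gt_eqF//.
apply: (le_trans (expectation_thinned r (@expectation_prod s) mu0)).
apply: le_trans _ (S_cap (rcons s r) eE).
rewrite [leRHS]big_mkcond/= size_rcons; apply: ler_prod => i _.
have m0 := mulr_ge0 (mu0 i) (S_ge0 (rcons s r) i).
rewrite addr_ge0//=; move: m0; rewrite /mu; case: (crosses (rcons s r) e i); rewrite ?mul1r//.
by rewrite mul0r mul0r addr0.
Qed.

(** Both sums telescope over arrivals: thinning pays the decrease of [S], and repair pays the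
    increase of [edge_opt] weighted by the overfull probability. *)
Lemma expectation_rejected_price s : expectation s (rejected_price s) <=
  \sum_(i < size s) price s i * (1 - S s i) + \sum_(e in E) lam^-1 * edge_opt cap s e.
Proof.
elim/last_ind: s => [|s r IH].
  rewrite /expectation/= /rejected_price !big_ord0 add0r; apply: sumr_ge0 => e _.
  by rewrite mulr_ge0 ?edge_opt_ge0// invr_ge0 (le_trans ler01).
pose D e := edge_opt cap (rcons s r) e - edge_opt cap s e.
have D0 e : 0 <= D e by rewrite subr_ge0 edge_opt_rcons.
rewrite expectation_rcons.
pose thin b := \sum_X coin_prob (past := s) r X * rejected_price (rcons s r) (thinned b X).
pose over e b := \sum_X coin_prob (past := s) r X *
    (cap e < usage (rcons s r) e (thinned b X))%N%:R.
apply: (@le_trans _ _ (expectation s (fun b => thin b + \sum_(e in E) D e * over e b))).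
  apply: ler_expectation => b sb bf; rewrite /round_step.
  under [X in _ + X]eq_bigr do rewrite mulr_sumr.
  rewrite exchange_big -big_split/=; apply: ler_sum => X _.
  under [X in _ + X]eq_bigr do rewrite mulrCA.
  rewrite -mulr_sumr -mulrDr ler_wpM2l ?coin_prob_ge0//.
  under eq_bigr do rewrite mulrC.
  apply: repaired_price bf _ => i si.
  rewrite (nth_thinned _ _ (widen_ord (leqnSn _) (Ordinal si)))/= nth_rcons sb si.
  by case/andP.
rewrite expectationD [X in _ + X <= _]expectation_sum.
(* The increments [D e] are deterministic, so only the overfull event is averaged. *)
have overD : \sum_(e in E) expectation s (fun b => D e * over e b) <=
    \sum_(e in E) lam^-1 * D e.
  apply: ler_sum => e eE; rewrite expectationZ mulrC ler_wpM2r//.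
  exact: overfull_prob.
have thinE b : size b = size s -> thin b = rejected_price s b +
    (\sum_(i < size s) price s i * (1 - keep s r i) * (nth false b i)%:R +
    cost r * (1 - S (rcons s r) (size s))).
  move=> sb; rewrite /thin /rejected_price size_rcons.
  under eq_bigr do rewrite mulr_sumr.
  rewrite exchange_big/= big_ord_recr/= price_last.
  rewrite addrA -big_split/=; congr (_ + _).
    apply: eq_bigr => i _; rewrite price_rcons//.
    under eq_bigr => X _.
      rewrite (nth_thinned _ _ (widen_ord (leqnSn _) i))/= nth_rcons sb ltn_ord.
      rewrite (_ : (~~ _)%:R = 1 - (nth false b i)%:R *
        (X (widen_ord (leqnSn (size s)) i))%:R); last first.
        by case: nth; case: (X _); rewrite /= ?mul1r ?mul0r ?subrr ?subr0.
      rewrite mulrCA mulrBr mulr1 mulrCA.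
      over.
    rewrite -mulr_sumr sumrB coin_prob_sum1 -mulr_sumr coin_prob_marginal/=.
    by case: nth => /=; ring.
  under eq_bigr => X _.
    rewrite (nth_thinned _ _ ord_max)/= nth_rcons sb ltnn eqxx/=.
    rewrite (_ : (~~ _)%:R = 1 - (X ord_max)%:R); last first.
      by case: (X _); rewrite /= ?subrr ?subr0.
    rewrite mulrCA mulrBr mulr1.
    over.
  by rewrite -mulr_sumr sumrB coin_prob_sum1 coin_prob_marginal/= keep_out.
(* An old request is still accepted with probability at most [S s i] and then lost with probability
   [1 - keep s r i]. *)
have thinD : expectation s thin <= expectation s (rejected_price s) +
    (\sum_(i < size s) price s i * (S s i - S (rcons s r) i) +
    cost r * (1 - S (rcons s r) (size s))).
  apply: (@le_trans _ _ (expectation s (fun b => rejected_price s b +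
    (\sum_(i < size s) price s i * (1 - keep s r i) * (nth false b i)%:R +
    cost r * (1 - S (rcons s r) (size s)))))).
    by apply: ler_expectation => b /thinE ->.
  rewrite !expectationD expectation_cst lerD2l lerD2r expectation_sum.
  apply: ler_sum => i _; rewrite expectationZ -(keepM s r i).
  rewrite -mulrA ler_wpM2l ?price_ge0//
    [S _ _ - _](_ : _ = (1 - keep s r i) * S s i); last by ring.
  by rewrite ler_wpM2l ?subr_ge0 ?keep_le1// expectation_accepted.
apply: (le_trans (lerD thinD overD)).
rewrite size_rcons big_ord_recr/= price_last.
under [X in _ <= X + _ + _]eq_bigr => i _ do rewrite price_rcons//.
rewrite [X in _ <= X + _ + _](_ : _ = \sum_(i < size s) price s i * (1 - S s i) +
  \sum_(i < size s) price s i * (S s i - S (rcons s r) i)); last first.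
  by rewrite -big_split/=; apply: eq_bigr => i _; ring.
rewrite [X in _ <= _ + X](_ : _ = \sum_(e in E) lam^-1 * edge_opt cap s e +
  \sum_(e in E) lam^-1 * D e); last first.
  by rewrite -big_split/=; apply: eq_bigr => e _; rewrite -mulrDr addrC subrK.
move: IH; lra.
Qed.

Lemma rounding_cost s : #|E|%:R <= lam ->
  expected_cost rounding_algorithm s <=
  \sum_(i < size s) price s i * (1 - S s i) + opt_cost cap s.
Proof.
move=> Elam; have lam0 : 0 < lam by exact: lt_le_trans lam_ge1.
rewrite expected_cost_rounding.
apply: (@le_trans _ _ (expectation s (rejected_price s))).
  by apply: ler_expectation => b sb _; rewrite rejection_costE.
apply: (le_trans (expectation_rejected_price s)); rewrite lerD2l -mulr_sumr.
rewrite mulrC ler_pdivrMr//.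
apply: (@le_trans _ _ (\sum_(e in E) opt_cost cap s)).
  by apply: ler_sum => e; exact: edge_opt_le_opt_cost.
rewrite sumr_const -mulr_natr ler_wpM2l//.
by have [b [_ _ ->]] := opt_cost_ex cap s; exact: rejected_price_ge0.
Qed.

End CompetitiveRatio.

End Rounding.

(** * Combining loads and rounding *)

Section Algorithm.
Variables (R : realType) (V : finType) (E : {set V * V}) (cap : V * V -> nat).
Notation request := (request R E).
Implicit Types (r : request) (s : seq request) (Y : nat -> R).

Let K : nat := \max_(e in E) cap e.
Let lam : R := #|E|.+2%:R.
Let kappa : R := kappa R K.

Let capK e : e \in E -> (cap e <= K)%N.
Proof. by move=> eE; exact: leq_bigmax_cond. Qed.

Definition valid_loads s Y : Prop :=
  [/\ forall i, 0 <= Y i, forall i, (size s <= i)%N -> Y i = 0,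
    forall i, (i < size s)%N -> Y i <= 2 * price s i,
    charged K (size s) (fun e => e \in E) (fun e => crosses s e) cap (price s) Y &
    covering K (size s) (fun e => e \in E) (fun e => crosses s e) cap (price s) Y].

Lemma valid_loads_nil : valid_loads [::] (fun=> 0).
Proof.
by split=> // [b _|e _]; rewrite ?big_ord0 ?mulr0 ?ler0n.
Qed.

Lemma valid_loads_rcons s r Y : valid_loads s Y ->
  exists Y', valid_loads (rcons s r) Y' /\ forall i, Y i <= Y' i.
Proof.
move=> [Y0 Yout Yp cY _].
have Ys : Y (size s) = 0 by exact: Yout.
have [|||Y' [le out Y'p cY' cov]] := @exists_covering R K (size (rcons s r)) _
    (fun e => e \in E) (fun e => crosses (rcons s r) e) cap
    (price (rcons s r)) capK (@price_gt0 _ _ _ _) Y.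
- by [].
- move=> i; rewrite size_rcons ltnS leq_eqVlt => /orP[/eqP ->|si].
    by rewrite Ys mulr_ge0// price_ge0.
  by rewrite price_rcons// Yp.
(* The newcomer has load 0, hence adds nothing to either side, and [b] restricts to a solution for
   [s]. *)
- move=> b; rewrite size_rcons => fb.
  rewrite !big_ord_recr/= Ys rejected_fraction0 !mulr0 !addr0.
  under eq_bigr => i _ do rewrite price_rcons//.
  apply: cY => e eE; apply: leq_trans (fb _ eE).
  rewrite big_ord_recr/= (leq_trans _ (leq_addr _ _))//.
  by apply: leq_sum => i _; rewrite crosses_rcons.
exists Y'; split=> //; split=> // [i|i si].
  exact: le_trans (le i).
by rewrite out// Yout// -ltnS -(size_rcons s r) ltnW.
Qed.

(** Choosing the update as a function of the state and folding it makes the loads online: those of a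
    prefix are fixed before later requests arrive. *)
Lemma exists_loads : exists load : seq request -> nat -> R,
  (forall s, valid_loads s (load s)) /\
  (forall s r i, load s i <= load (rcons s r) i).
Proof.
have /choice[next nextP] : forall x : (seq request * (nat -> R)) * request,
    exists Y', valid_loads x.1.1 x.1.2 ->
    valid_loads (rcons x.1.1 x.2) Y' /\ forall i, x.1.2 i <= Y' i.
  move=> [[s Y] r] /=; have [vY|nvY] := pselect (valid_loads s Y); last by exists Y.
  by have [Y' ?] := valid_loads_rcons r vY; exists Y'.
pose run s := foldl (fun x r => (rcons x.1 r, next (x, r))) ([::], fun=> 0) s.
have run1 s : (run s).1 = s.
  by elim/last_ind: s => // s r IH; rewrite /run foldl_rcons; exact: (congr1 (rcons^~ r)).
have runS s r : (run (rcons s r)).2 = next (run s, r).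
  by rewrite /run foldl_rcons.
have valid s : valid_loads s (run s).2.
  elim/last_ind: s => [|s r IH]; first exact: valid_loads_nil.
  by rewrite runS; have := nextP (run s, r); rewrite /= run1 => /(_ IH)[].
exists (fun s => (run s).2); split=> // s r i.
by rewrite runS; have := nextP (run s, r); rewrite /= run1 => /(_ (valid s))[].
Qed.

(** With [z = ln lam * x], the nontrivial case reads [lam - 2 * (lam - 1) * z <= lam * (1 - z) <=
    lam * expR (- z)]; the first step uses [2 <= lam], which the shift in [lam] secures even without
    edges. *)
Lemma survival_le (x : R) : 0 <= x -> x <= 1 ->
  1 + (lam - 1) * Num.max 0 (1 - 2 * ln lam * x) <= expR (ln lam * (1 - x)).
Proof.
move=> x0 x1; have lam2 : 2 <= lam by rewrite ler_nat.
have l0 : 0 <= ln lam by apply: ln_ge0; lra.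
have [_|lx] := leP (1 - 2 * ln lam * x) 0.
  by rewrite mulr0 addr0 -[leLHS]expR0 ler_expR mulr_ge0 ?subr_ge0.
rewrite [ln lam * (1 - x)]mulrBr mulr1 expRD lnK ?posrE; last by lra.
have := expR_ge1Dx (- (ln lam * x)); set y := expR _ => hy.
have := mulr_ge0 l0 x0; set z := ln lam * x in lx hy *.
have -> : 2 * ln lam * x = 2 * z by rewrite /z mulrA.
move=> z0; nra.
Qed.

Lemma exists_competitive_algorithm :
  exists A : online_algorithm R E cap,
    competitive (16 * ln lam * kappa + 1) A.
Proof.
have [load [loadP load_mono]] := exists_loads.
pose g s i := rejected_fraction K (price s i) (load s i).
pose S s i : R := Num.max 0 (1 - 2 * ln lam * g s i).
have lam2 : 2 <= lam by rewrite ler_nat.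
have l0 : 0 <= ln lam by apply: ln_ge0; lra.
have g0 s i : 0 <= g s i.
  by have [Y0 _ _ _ _] := loadP s; rewrite rejected_fraction_ge0// price_ge0.
have S_ge0 s i : 0 <= S s i by rewrite le_max lexx.
have S_le1 s i : S s i <= 1.
  by rewrite ge_max ler01 gerBl !mulr_ge0.
have S_out s i : (size s <= i)%N -> S s i = 1.
  move=> si; have [_ Yout _ _ _] := loadP s.
  by rewrite /S /g Yout// rejected_fraction0 mulr0 subr0; apply/max_idPr.
have S_rcons s r i : S (rcons s r) i <= S s i.
  have [si|si] := ltnP i (size s); last by rewrite (S_out s).
  rewrite /S ge_max le_max lexx/= le_max; apply/orP; right.
  rewrite lerD2l lerN2 ler_wpM2l ?mulr_ge0// /g price_rcons//.
  by rewrite le_rejected_fraction ?price_ge0.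
have S_cap s e : e \in E ->
    \prod_(i < size s | crosses s e i) (1 + (lam - 1) * S s i) <= lam ^+ cap e.
  move=> eE; have [_ _ _ _ /(_ e eE) cov] := loadP s.
  (* By [survival_le] the product is at most the exponential of [ln lam] times the fractional usage
     of [e], which covering bounds by [cap e]. *)
  apply: (@le_trans _ _ (expR (ln lam * (cap e)%:R))); last first.
    by rewrite mulrC expRM_natl lnK// posrE; lra.
  apply: (@le_trans _ _
    (expR (ln lam * \sum_(i < size s | crosses s e i) (1 - g s i)))); last first.
    by rewrite ler_expR ler_wpM2l.
  rewrite mulr_sumr expR_sum; apply: ler_prod => i _.
  rewrite survival_le ?rejected_fraction_le1// andbT addr_ge0// mulr_ge0//; lra.
exists (rounding_algorithm cap S_ge0 S_rcons) => s.
have lam1 : 1 <= lam by rewrite ler1n.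
have Elam : #|E|%:R <= lam by rewrite ler_nat -addn2 leq_addr.
apply: (le_trans (rounding_cost S_ge0 S_out S_rcons lam1 S_cap s Elam)).
rewrite mulrDl mul1r lerD2r.
have [b [_ bf ->]] := opt_cost_ex cap s.
have [Y0 _ Yp cY _] := loadP s.
apply: (@le_trans _ _ (2 * ln lam * \sum_(i < size s) price s i * g s i)).
  rewrite mulr_sumr; apply: ler_sum => i _.
  rewrite mulrCA ler_wpM2l ?price_ge0// lerBlDr -lerBlDl /S le_max.
  by rewrite lexx orbT.
have := cY (nth false b); rewrite -/kappa => cYb.
have k0 : 0 <= kappa by exact/ltW/kappa_gt0.
(* The constant 16: 2 from thinning, 4 from charging, 2 from [Y i <= 2 p i]. The extra 1 paid for
   the repairs. *)
apply: (@le_trans _ _ (2 * ln lam * (4 * kappa * (2 * rejected_price s b)))); last first.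
  by rewrite le_eqVlt; apply/orP; left; apply/eqP; ring.
rewrite ler_wpM2l ?mulr_ge0//; apply: (le_trans (cYb _)).
  by move=> e eE; move: bf; rewrite feasibleE => /forall_inP/(_ e eE).
rewrite ler_wpM2l ?mulr_ge0// /rejected_price mulr_sumr; apply: ler_sum => i _.
by case: nth; rewrite /= ?mulr0 ?mul0r ?mul1r ?mulr1// Yp.
Qed.

End Algorithm.

Theorem theorem2 (R : realType) :
  exists beta : nat -> R,
    beta =O_\oo (fun n : nat => ln (n%:R : R) ^+ 2) /\
    forall (V : finType) (E : {set V * V}) (cap : V * V -> nat),
      (forall e, e \in E -> (0 < cap e)%N) ->
      exists A : online_algorithm R E cap,
        competitive (beta (#|E| * \max_(e in E) cap e)%N) A.
Proof.
exists (fun n => 16 * ln n.+2%:R ^+ 2 + 1); split.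
  (* [65 = 16 * 2 ^ 2 + 1]: [n + 2 <= n ^ 2] doubles the logarithm at most, and [1 <= ln n] absorbs
     the additive 1. *)
  apply/eqO_exP; exists 65 => //; near=> n.
  have e_le_n : expR 1 <= n%:R :> R by near: n; exact: nbhs_infty_ger.
  have n2 : (2 <= n)%N by near: n; exact: nbhs_infty_ge.
  have n0 : 0 < n%:R :> R by rewrite ltr0n; lia.
  have ln1 : 1 <= ln n%:R :> R.
    by rewrite -[leLHS](expRK 1) ler_ln ?posrE ?expR_gt0.
  have ln2 : ln n.+2%:R <= 2 * ln n%:R :> R.
    rewrite mulr_natl -lnXn// ler_ln ?posrE ?exprn_gt0//.
    by rewrite -natrX ler_nat; nia.
  have ln0 : 0 <= ln n.+2%:R :> R by apply: ln_ge0; rewrite ler1n.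
  rewrite !ger0_norm ?sqr_ge0 ?addr_ge0 ?mulr_ge0 ?sqr_ge0//; nra.
move=> V E cap cap0; have [A AC] := exists_competitive_algorithm R E cap.
exists A => s; apply: (le_trans (AC s)); rewrite ler_wpM2r//.
  by have [b [_ _ ->]] := opt_cost_ex cap s; exact: rejected_price_ge0.
rewrite lerD2r -mulrA ler_wpM2l// /kappa expr2.
set m := #|E|; set K := \max_(e in E) cap e.
(* Without edges both numbers vanish; otherwise both are positive since capacities are. *)
have [mK Km] : (m <= m * K /\ K <= m * K)%N.
  have [E0|[e eE]] := set_0Vmem E.
    by rewrite /m /K E0 cards0 big_set0.
  have K0 : (0 < K)%N by apply: leq_trans (cap0 _ eE) _; exact: leq_bigmax_cond.
  have m0 : (0 < m)%N by apply/card_gt0P; exists e.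
  by rewrite leq_pmulr// leq_pmull.
by apply: ler_pM; rewrite ?ln_ge0 ?ler1n// ler_ln ?posrE ?ltr0n// ler_nat !ltnS.
Unshelve. all: by end_near.
Qed.
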